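(* Let $G$ be a finite simple graph and let $S\subseteq E(G)$. For every $t\ge 1$ let $G_t=G_t(S)$ and $H_t=H_t(S)$ be as defined in the context. Then for every fixed positive integer $k$, the sequences $\{\lambda_{|G_t|-k+1}(G_t)\}_{t\in\mathbb{N}}$ and $\{\lambda_{|H_t|-k+1}(H_t)\}_{t\in\mathbb{N}}$ (the $k$-th smallest eigenvalues) are Cauchy sequences, and \[\lim_{t\to\infty}\lambda_{|G_t|-k+1}(G_t)=\lim_{t\to\infty}\lambda_{|H_t|-k+1}(H_t).\]
   Context: For a finite simple graph $F$ on $m$ vertices, $\lambda_1(F)\ge\lambda_2(F)\ge\cdots\ge\lambda_m(F)$ denote the eigenvalues of its adjacency matrix, and $|F|$ denotes its number of vertices. Given a graph $G$ and $S\subseteq E(G)$, for $t\ge1$ the graph $G_t(S)$ is obtained from $G$ by replacing each edge $uv\in S$ by a path $P_{uv}$ of length $t$ (i.e. $t$ edges, with $t-1$ new internal vertices) between $u$ and $v$; in particular $G_1(S)=G$ and $|G_t(S)|=|G|+(t-1)|S|$. The graph $H_t(S)$ is obtained from $G_{2t+1}(S)$ by deleting the middle edge of each path $P_{uv}$, $uv\in S$ (each such path has $2t+1$ edges, so it has a unique middle edge); thus $|H_t(S)|=|G|+2t|S|$. *)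

(* Defs.v *)
From HB Require Import structures.
From mathcomp Require Import all_boot all_order all_algebra.
From mathcomp Require Import polyrcf reals.
Import Order.TTheory GRing.Theory Num.Theory.

Set Implicit Arguments.
Unset Strict Implicit.
Unset Printing Implicit Defensive.

Local Open Scope ring_scope.

(* A finite simple graph is a symmetric irreflexive [e : rel T], [T : finType]. *)

Definition edge_set (T : finType) (e : rel T) : {set {set T}} :=
  [set [set p.1; p.2] | p : T * T & e p.1 p.2].

Definition adjacency_mx (R : realType) (T : finType) (e : rel T) :
  'M[R]_#|T| := \matrix_(i, j) (e (enum_val i) (enum_val j))%:R.

(* The real eigenvalues of [A], in nonincreasing order ([rootsR] is increasing),
   repeated according to algebraic multiplicity. For symmetric [A] there are
   exactly [n] of them. *)
Definition eigenvalues (R : realType) (n : nat) (A : 'M[R]_n) : seq R :=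
  rev (flatten [seq nseq (mup x (char_poly A)) x | x <- rootsR (char_poly A)]).

(* [lambda R e i] is the i-th largest eigenvalue of the graph, for
   1 <= i <= #|T|. *)
Definition lambda (R : realType) (T : finType) (e : rel T) (i : nat) : R :=
  (eigenvalues (adjacency_mx R e))`_i.-1.

Section Subdivision.
Local Open Scope nat_scope.
Variables (T : finType) (e : rel T) (S : {set {set T}}).

(* Each edge of [S], oriented along the enumeration of [T] so that it is
   represented by exactly one ordered pair. *)
Definition arcs : {set T * T} :=
  [set p | (enum_rank p.1 < enum_rank p.2) && ([set p.1; p.2] \in S)].

Definition arc := {p : T * T | p \in arcs}.

Definition subdiv_vertex (t : nat) : finType := (T + arc * 'I_t.-1)%type.

(* The i-th vertex of the path P_uv of length t, for 0 <= i <= t: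
   u for i = 0, v for i = t, and the new vertex [(uv, i - 1)] in between. *)
Definition path_vertex (t : nat) (a : arc) (i : nat) : subdiv_vertex t :=
  if i == 0 then inl (val a).1
  else if insub i.-1 is Some j then inr (a, j) else inl (val a).2.

Definition kept_edge (t : nat) (x y : subdiv_vertex t) : bool :=
  match x, y with
  | inl u, inl v => e u v && ([set u; v] \notin S)
  | _, _ => false
  end.

(* [path_edge a i x y]: {x, y} is the i-th edge of the path P_a, 0 <= i < t. *)
Definition path_edge (t : nat) (a : arc) (i : nat) (x y : subdiv_vertex t) :=
  [set x; y] == [set path_vertex t a i; path_vertex t a i.+1].

(* G_t(S), for t >= 1 *)
Definition subdivision (t : nat) : rel (subdiv_vertex t) := fun x y =>
  kept_edge x y || [exists a : arc, exists i : 'I_t, path_edge a i x y].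

(* H_t(S): the edges of a path of length 2t+1 are numbered 0, ..., 2t, so the
   middle one has number t. *)
Definition cut_subdivision (t : nat) : rel (subdiv_vertex (2 * t + 1)) :=
  fun x y => subdivision x y && ~~ [exists a : arc, path_edge a t x y].

End Subdivision.

Arguments subdivision {T} e S t _ _.
Arguments cut_subdivision {T} e S t _ _.

(* Sanity checks: G_t(S) and H_t(S) are simple graphs of the expected orders. *)
Section SubdivisionTheory.
Local Open Scope nat_scope.
Variables (T : finType) (e : rel T) (S : {set {set T}}).
Hypotheses (esym : symmetric e) (eirr : irreflexive e).
Hypothesis (SE : S \subset edge_set e).

Lemma path_vertex_neq t (a : arc S) (i : 'I_t) :
  path_vertex t a i != path_vertex t a i.+1.
Proof.
case: a i => [[u v] uvS] [i it]; rewrite /path_vertex /=.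
case: i it => [|i] it /=.
  case: insubP => [//|_]; apply/eqP => -[uv].
  by move: uvS; rewrite inE /= uv ltnn.
have it1 : i < t.-1 by case: t it.
rewrite insubT; case: insubP => [j _ ji|_] //; apply/eqP => -[/(congr1 val)/=].
by rewrite ji => /n_Sn.
Qed.

Lemma subdivision_sym t : symmetric (subdivision e S t).
Proof.
move=> x y; rewrite /subdivision /path_edge setUC; congr (_ || _).
by case: x y => [u|?] [v|?] //=; rewrite esym setUC.
Qed.

Lemma subdivision_irr t : irreflexive (subdivision e S t).
Proof.
move=> x; apply/negbTE; rewrite /subdivision negb_or; apply/andP; split.
  by case: x => [u|?] //=; rewrite eirr.
apply/existsP => -[a /existsP[i /eqP/(congr1 (fun A : {set _} => #|A|))]].
by rewrite !cards2 eqxx path_vertex_neq.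
Qed.

Lemma cut_subdivision_sym t : symmetric (cut_subdivision e S t).
Proof.
by move=> x y; rewrite /cut_subdivision subdivision_sym /path_edge setUC.
Qed.

Lemma cut_subdivision_irr t : irreflexive (cut_subdivision e S t).
Proof. by move=> x; rewrite /cut_subdivision subdivision_irr. Qed.

Lemma card_arcs : #|arcs S| = #|S|.
Proof.
have inj : {in arcs S &, injective (fun p : T * T => [set p.1; p.2])}.
  move=> [u v] [u' v']; rewrite !inE /= => /andP[uv _] /andP[uv' _] E.
  have := set21 u v; have := set22 u v; rewrite E !inE.
  move=> /orP[]/eqP ? /orP[]/eqP ?; subst=> //; first by rewrite ltnn in uv.
  - by have := ltn_trans uv uv'; rewrite ltnn.
  - by rewrite ltnn in uv.
rewrite -(card_in_imset inj); apply: eq_card => s; apply/imsetP/idP.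
  by case=> p; rewrite inE => /andP[_ pS] ->.
move=> sS; have /imsetP[[u v]] := subsetP SE _ sS.
rewrite inE /= => uv s_uv.
have : enum_rank u != enum_rank v :> nat.
  apply: contraTneq uv => /ord_inj/enum_rank_inj ->; by rewrite eirr.
rewrite neq_ltn => /orP[lt|lt]; [exists (u, v)|exists (v, u)] => //=;
  rewrite ?inE /= ?lt -?s_uv ?sS // setUC -?s_uv //.
Qed.

Lemma card_subdiv_vertex t : #|subdiv_vertex S t| = #|T| + (t - 1) * #|S|.
Proof.
by rewrite card_sum card_prod card_ord card_sig card_arcs mulnC subn1.
Qed.

End SubdivisionTheory.

(* Main.v *)
Require Import Defs.
From HB Require Import structures.
From mathcomp Require Import all_boot all_order all_algebra.
From mathcomp Require Import all_classical all_reals all_analysis.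
From mathcomp Require Import polyrcf complex ring lra zify.
Import Order.TTheory GRing.Theory Num.Theory numFieldNormedType.Exports.

Set Implicit Arguments.
Unset Strict Implicit.
Unset Printing Implicit Defensive.

(* By Courant-Fischer, the k-th smallest eigenvalue mu_k of a graph is the least
   mu such that some k-dimensional space of functions has quadratic form at most
   mu. Hence mu_k decreases when passing to a larger graph containing the given
   one as an induced subgraph. H_t is induced in H_(t+1), so mu_k(H_t) is
   nonincreasing; it is bounded below because the degrees are, so it converges.
   H_t is also induced in G_s when s >= 2t + 2, whence mu_k(G_s) <= mu_k(H_t).
   Conversely, an orthonormal frame of k functions on G_s has total mass k, so by
   pigeonhole there is a position j in the middle of the paths such that cutting
   the j-th edge of every path changes the quadratic form on the frame by at most
   2k/(s-2). The cut graph is induced in H_s, whence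
   mu_k(H_s) <= mu_k(G_s) + 2k/(s-2), and both sequences have the same limit. *)

Local Open Scope ring_scope.

(** * The spectral theorem for real symmetric matrices *)

Lemma mulmx_tr_gt0 (R : realFieldType) n (v : 'rV[R]_n) :
  v != 0 -> 0 < (v *m v^T) 0 0.
Proof.
move=> v0; rewrite mxE lt_def; apply/andP; split; last first.
  by apply: sumr_ge0 => j _; rewrite mxE -expr2 sqr_ge0.
apply: contra v0 => /eqP h; apply/eqP/rowP => j; rewrite mxE.
have /psumr_eq0P/(_ h) : forall i, true -> 0 <= v 0 i * v^T i 0.
  by move=> i _; rewrite mxE -expr2 sqr_ge0.
by move=> /(_ j isT) /eqP; rewrite mxE mulf_eq0 orbb => /eqP.
Qed.

(** Over [R[i]] there is an eigenvector x + iy with eigenvalue a + ib. Symmetry of [A] equates the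
    pairings of xA with y and of yA with x, which forces b(|x|^2 + |y|^2) = 0. So b = 0, and
    whichever of x, y is nonzero is a real eigenvector. *)
Lemma sym_eigenvector (R : rcfType) n (A : 'M[R]_n.+1) :
  A^T = A -> exists a (v : 'rV[R]_n.+1), v != 0 /\ v *m A = a *: v.
Proof.
move=> Asym.
have [z /eigenvalueP[v vA v0]] :=
  @spectral.eigenvalue_closed R[i] _ (map_mx (real_complex R) A) isT.
pose x := map_mx (@complex.Re R) v; pose y := map_mx (@complex.Im R) v.
case: z vA => a b vA.
have xA : x *m A = a *: x - b *: y.
  apply/rowP => j; move/rowP/(_ j): vA; rewrite !mxE => /(congr1 (@complex.Re R)).
  rewrite raddf_sum /= => h; case: (v 0 j) h => p q /= <-.
  by apply: eq_bigr => i _; rewrite !mxE; case: (v 0 i) => p' q' /=; ring.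
have yA : y *m A = b *: x + a *: y.
  apply/rowP => j; move/rowP/(_ j): vA; rewrite !mxE => /(congr1 (@complex.Im R)).
  rewrite raddf_sum /= => h; case: (v 0 j) h => p q /=; rewrite [_ + b * p]addrC => <-.
  by apply: eq_bigr => i _; rewrite !mxE; case: (v 0 i) => p' q' /=; ring.
have dotC (s u : 'rV[R]_n.+1) : (s *m u^T) 0 0 = (u *m s^T) 0 0.
  by rewrite -[s *m _]trmxK trmx_mul trmxK mxE.
have : (x *m A *m y^T) 0 0 = (y *m A *m x^T) 0 0.
  by rewrite dotC trmx_mul Asym mulmxA.
have eD (p q : R) (s u w : 'rV[R]_n.+1) :
    ((p *: s + q *: u) *m w^T) 0 0 = p * (s *m w^T) 0 0 + q * (u *m w^T) 0 0.
  by rewrite mulmxDl -!scalemxAl !mxE.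
rewrite xA yA -scaleNr !eD [(y *m x^T) 0 0]dotC => h.
have b0 : b = 0.
  have hb : b * ((x *m x^T) 0 0 + (y *m y^T) 0 0) = 0 by lra.
  move/eqP: hb; rewrite mulf_eq0 => /orP[/eqP//|].
  have ge0 (s : 'rV[R]_n.+1) : 0 <= (s *m s^T) 0 0.
    by rewrite mxE; apply: sumr_ge0 => j _; rewrite mxE -expr2 sqr_ge0.
  rewrite paddr_eq0 // => /andP[/eqP hx /eqP hy]; case/eqP: v0.
  have x0 : x = 0 by apply/eqP; apply: contraT => /mulmx_tr_gt0; rewrite hx ltxx.
  have y0 : y = 0 by apply/eqP; apply: contraT => /mulmx_tr_gt0; rewrite hy ltxx.
  apply/rowP => j; move/rowP/(_ j): x0; move/rowP/(_ j): y0; rewrite !mxE.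
  by case: (v 0 j) => p q /= -> ->.
rewrite b0 !scale0r subr0 add0r in xA yA.
have [x0|x0] := eqVneq x 0; last by exists a, x.
exists a, y; split=> //; apply: contra v0 => /eqP y0.
apply/eqP/rowP => j; move/rowP/(_ j): x0; move/rowP/(_ j): y0; rewrite !mxE.
by case: (v 0 j) => p q /= -> ->.
Qed.

(* The Householder reflection exchanging [v] and the first basis vector. *)
Lemma orthogonal_row0 (R : rcfType) n (v : 'rV[R]_n.+1) : (v *m v^T) 0 0 = 1 ->
  exists Q : 'M[R]_n.+1, Q *m Q^T = 1%:M /\ delta_mx 0 0 *m Q = v.
Proof.
move=> v1; pose d := delta_mx 0 0 : 'rV[R]_n.+1.
have [->|vd] := eqVneq v d; first by exists 1%:M; rewrite trmx1 !mulmx1.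
pose w := v - d; have w0 : w != 0 by rewrite subr_eq0.
have w_gt0 := mulmx_tr_gt0 w0; pose c := (w *m w^T) 0 0.
have cE : w *m w^T = c%:M by exact: mx11_scalar.
have dE (u : 'rV[R]_n.+1) : (d *m u^T) 0 0 = u 0 0.
  by rewrite -rowE !mxE.
have ud (u : 'rV[R]_n.+1) : (u *m d^T) 0 0 = u 0 0.
  by rewrite -[u *m _]trmxK trmx_mul trmxK mxE dE.
have subE (M N : 'M[R]_1) : (M - N) 0 0 = M 0 0 - N 0 0 by rewrite !mxE.
(* As [v] and [d] are unit vectors, |v - d|^2 = 2(1 - v_0). This is the value for which the
   reflection along [w] sends [d] to d + w = v. *)
have c2 : c = 2 * (1 - v 0 0).
  have -> : c = (v *m v^T) 0 0 - (v *m d^T) 0 0 - ((d *m v^T) 0 0 - (d *m d^T) 0 0).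
    by rewrite /c /w [(v - d)^T]raddfB /= mulmxBl !mulmxBr !subE.
  by rewrite v1 ud !dE [d 0 0]mxE !eqxx mulr1n; lra.
have c0 : c != 0 by rewrite gt_eqF.
exists (1%:M - (2 / c) *: (w^T *m w)); split.
  have MT : (w^T *m w)^T = w^T *m w by rewrite trmx_mul trmxK.
  have MM : (w^T *m w) *m (w^T *m w) = c *: (w^T *m w).
    by rewrite mulmxA -[_ *m w *m _]mulmxA cE mul_mx_scalar -scalemxAl.
  move: (w^T *m w) MT MM => M MT MM.
  have -> : (1%:M - (2 / c) *: M)^T = 1%:M - (2 / c) *: M.
    by rewrite linearB /= linearZ /= MT trmx1.
  rewrite mulmxBl !mulmxBr !mul1mx !mulmx1 -!scalemxAl -!scalemxAr MM.
  rewrite !scalerA -addrA -opprD -[RHS]subr0; congr (_ - _).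
  rewrite -scalerBl -scalerDl (_ : _ + _ = 0) ?scale0r //; by field.
rewrite mulmxBr mulmx1 -scalemxAr mulmxA [d *m w^T]mx11_scalar dE mul_scalar_mx.
rewrite scalerA [w 0 0](_ : _ = v 0 0 - 1); last by rewrite !mxE eqxx.
rewrite (_ : 2 / c * _ = -1) ?scaleN1r ?opprK ?subrKC //.
by rewrite c2 in c0 *; field; move: c0; rewrite mulf_eq0 pnatr_eq0.
Qed.

(** Deflation: conjugating by an orthogonal [Q] whose first row is a unit eigenvector makes the
    first row of [B] a multiple of the first basis vector. By symmetry [B] is then block diagonal,
    and induction treats the lower block. *)
Lemma sym_spectral (R : rcfType) n (A : 'M[R]_n) : A^T = A ->
  exists (P : 'M[R]_n) (d : 'rV[R]_n), P *m P^T = 1%:M /\ A = P^T *m diag_mx d *m P.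
Proof.
elim: n A => [|n IH] A Asym.
  by exists 1%:M, 0; split; apply/matrixP => -[].
have [a [v [v0 vA]]] := sym_eigenvector Asym.
have r_gt0 := mulmx_tr_gt0 v0; set r := (v *m v^T) 0 0 in r_gt0.
have [|Q [QQ dQ]] := @orthogonal_row0 R n ((Num.sqrt r)^-1 *: v).
  rewrite linearZ /= -scalemxAl -scalemxAr scalerA [LHS]mxE -/r -invfM -expr2.
  by rewrite sqr_sqrtr ?ltW // mulVf // gt_eqF.
have QtQ : Q^T *m Q = 1%:M by apply: mulmx1C.
pose B : 'M[R]_(1 + n) := Q *m A *m Q^T.
have Bsym : B^T = B by rewrite /B !trmx_mul trmxK Asym mulmxA.
have B0 : row 0 B = a *: delta_mx 0 0.
  rewrite rowE /B !mulmxA dQ -scalemxAl vA scalerA mulrC -scalerA -dQ -scalemxAl.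
  by rewrite -mulmxA QQ mulmx1.
have Bur : ursubmx B = 0.
  apply/matrixP => i j; rewrite !mxE; move/rowP/(_ (rshift 1 j)): B0.
  by rewrite !mxE ord1 lshift0 => ->; rewrite andbF mulr0.
have Bdl : dlsubmx B = 0 by rewrite -Bsym -trmx_ursub Bur trmx0.
have [|P [d [PP dE]]] := IH (drsubmx B).
  by rewrite trmx_drsub Bsym.
pose K : 'M[R]_(1 + n) := block_mx 1%:M 0 0 P.
have KK : K *m K^T = 1%:M.
  rewrite /K tr_block_mx mulmx_block !trmx0 trmx1.
  by rewrite !mul0mx !mulmx0 !mul1mx !addr0 add0r PP -scalar_mx_block.
have BE : B = K^T *m diag_mx (row_mx (ulsubmx B) d) *m K.
  rewrite -{1}[B]submxK Bur Bdl dE /K tr_block_mx diag_mx_row.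
  rewrite !mulmx_block !trmx0 trmx1.
  rewrite !mul0mx !mulmx0 !mul1mx !mulmx1 !addr0 !add0r !mul0mx.
  suff -> : diag_mx (ulsubmx B) = ulsubmx B by [].
  by rewrite [RHS]mx11_scalar; apply/matrixP => i j; rewrite !ord1 !mxE.
clearbody K; have -> : A = Q^T *m B *m Q.
  by rewrite /B !mulmxA QtQ mul1mx -mulmxA QtQ mulmx1.
exists ((K : 'M[R]_n.+1) *m Q), (row_mx (ulsubmx B) d); split.
  by rewrite trmx_mul mulmxA -[_ *m Q *m _]mulmxA QQ mulmx1.
by rewrite trmx_mul {1}BE !mulmxA.
Qed.

(** * Eigenvalues and the Courant-Fischer principle *)

Lemma char_poly_spectral (R : comNzRingType) n (P : 'M[R]_n) (d : 'rV[R]_n) :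
  P *m P^T = 1%:M ->
  char_poly (P^T *m diag_mx d *m P) = \prod_(i < n) ('X - (d 0 i)%:P).
Proof.
move=> PP; have PtP := mulmx1C PP.
transitivity (char_poly (diag_mx d)).
  rewrite /char_poly; set D := diag_mx d.
  have -> : char_poly_mx (P^T *m D *m P) =
            map_mx polyC P^T *m char_poly_mx D *m map_mx polyC P.
    rewrite /char_poly_mx mulmxBr mulmxBl !map_mxM /= mul_mx_scalar -scalemxAl.
    by rewrite -(map_mxM _ P^T P) PtP map_mx1 scalemx1.
  by rewrite !det_mulmx mulrAC -det_mulmx -map_mxM PtP map_mx1 det1 mul1r.
rewrite char_poly_trig ?diag_mx_is_trig //; apply: eq_bigr => i _.
by rewrite mxE eqxx.
Qed.

Lemma sorted_flatten_nseq (R : realDomainType) (m : R -> nat) (s : seq R) :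
  sorted <%R s -> sorted <=%R (flatten [seq nseq (m x) x | x <- s]).
Proof.
rewrite lt_sorted_pairwise le_sorted_pairwise.
elim: s => //= x s IH /andP[/allP xs /IH {}IH].
rewrite pairwise_cat IH andbT; apply/andP; split.
  apply/allrelP => y z; rewrite mem_nseq => /andP[_ /eqP ->].
  move=> /flattenP[_ /mapP[u us ->]]; rewrite mem_nseq => /andP[_ /eqP ->].
  exact/ltW/xs.
elim: (m x) => //= p ->; rewrite andbT; apply/allP => y.
by rewrite mem_nseq => /andP[_ /eqP ->].
Qed.

(** Every [x] occurs in both lists [mup x (char_poly A)] times; a non-root occurs in neither. *)
Lemma perm_eigenvalues (R : realType) n (A : 'M[R]_n) (s : seq R) :
  char_poly A = \prod_(x <- s) ('X - x%:P) -> perm_eq (eigenvalues A) s.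
Proof.
move=> pE; rewrite /eigenvalues perm_rev; apply/allP => x _ /=; apply/eqP.
have p0 : char_poly A != 0 by rewrite monic_neq0 // char_poly_monic.
rewrite count_flatten -map_comp sumnE big_map.
transitivity (\sum_(y <- rootsR (char_poly A) | y == x) mup y (char_poly A))%N.
  rewrite [RHS]big_mkcond /=; apply: eq_bigr => y _ /=.
  by rewrite count_nseq /= eq_sym; case: eqP; rewrite ?mul1n ?mul0n.
have [xr|xr] := boolP (root (char_poly A) x).
  rewrite -big_filter filter_pred1_uniq ?uniq_roots //.
    by rewrite big_seq1 pE mu_prod_XsubC.
  by have := roots_on_rootsR p0 x; rewrite inE /= => <-.
rewrite big1_seq; last by move=> y /andP[/eqP ->]; rewrite mupNroot.
by rewrite -(mu_prod_XsubC x s) -pE mupNroot.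
Qed.

(** Index [size s - k], counted from 0 in the nonincreasing list, holds the k-th smallest entry.
    Bounding it becomes a count that does not depend on the order of [s]. *)
Lemma nth_eigenvalues_le (R : realType) n (A : 'M[R]_n) (s : seq R) k mu :
  char_poly A = \prod_(x <- s) ('X - x%:P) -> (0 < k <= size s)%N ->
  ((eigenvalues A)`_(size s - k) <= mu) = (k <= count (<= mu) s)%N.
Proof.
move=> pE /andP[k0 kn]; have := perm_eigenvalues pE.
rewrite /eigenvalues; set t := flatten _ => pe.
have ss : sorted <=%R t by apply/sorted_flatten_nseq/sorted_roots.
have st : size t = size s by rewrite -(perm_size pe) size_rev.
have ct : count (<= mu) t = count (<= mu) s by rewrite -(permP pe) count_rev.
have kn' : (size s - k < size s)%N by rewrite ltn_subrL k0 (leq_trans k0).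
have km : (size s - (size s - k).+1 = k.-1)%N by rewrite subnS subKn.
rewrite nth_rev st // km -ct.
have [h|h] := leqP k (count (<= mu) t).
  by apply: nth_count_le => //; rewrite prednK.
by apply/negbTE; rewrite -ltNge; apply: nth_count_gt; rewrite // st -ltnS prednK // h.
Qed.

(** The quadratic form of the adjacency matrix; each edge counts twice, once per orientation. *)
Definition qform (R : realType) (V : finType) (e : rel V) (f : V -> R) : R :=
  \sum_x \sum_y (e x y)%:R * (f x * f y).

Definition comb (R : realType) (V : finType) k (w : 'I_k -> V -> R)
    (c : 'I_k -> R) : V -> R :=
  fun x => \sum_i c i * w i x.

(* The frame [w] is orthonormal, in the form stable under [extend]: [c] is
   mapped isometrically to [comb w c]. *)
Definition low_frame (R : realType) (V : finType) k (e : rel V) (mu : R) :=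
  exists w : 'I_k -> V -> R, forall c,
    \sum_x comb w c x ^+ 2 = \sum_i c i ^+ 2 /\
    qform e (comb w c) <= mu * \sum_i c i ^+ 2.

(** A sum over fibres, which for injective [g] is extension by zero outside the image; this form
    needs no choice of preimages. *)
Definition extend (R : realType) (V U : finType) (g : V -> U) (f : V -> R) : U -> R :=
  fun y => \sum_(x | g x == y) f x.

Section Extend.
Variables (R : realType) (V U : finType) (g : V -> U) (ginj : injective g).

Lemma extend_inj (f : V -> R) x : extend g f (g x) = f x.
Proof.
by rewrite /extend (big_pred1 x) // => y /=; rewrite (inj_eq ginj).
Qed.

Lemma extend_out (f : V -> R) y : y \notin codom g -> extend g f y = 0.
Proof.
move=> yg; rewrite /extend big_pred0 // => x; apply: contraNF yg => /eqP <-.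
exact: codom_f.
Qed.

Lemma sum_codom (F : U -> R) :
  (forall y, y \notin codom g -> F y = 0) -> \sum_y F y = \sum_x F (g x).
Proof.
move=> F0; rewrite (bigID (mem (codom g))) /= [X in _ + X]big1 // addr0.
rewrite -big_uniq; last exact/injectiveP.
by rewrite /codom big_image.
Qed.

Lemma extend_comb k (w : 'I_k -> V -> R) c y :
  comb (fun i => extend g (w i)) c y = extend g (comb w c) y.
Proof.
rewrite /comb /extend exchange_big /=; apply: eq_bigr => i _.
by rewrite mulr_sumr.
Qed.

End Extend.

(** The spectral theorem carried from matrices to functions on [V]: [p i] is the i-th row of the
    orthogonal matrix, and the last two clauses are Parseval's identity and the diagonalised
    form. *)
Lemma graph_eigenbasis (R : realType) (V : finType) (e : rel V) : symmetric e ->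
  exists (p : 'I_#|V| -> V -> R) (d : 'I_#|V| -> R),
  [/\ char_poly (adjacency_mx R e) =
        \prod_(x <- [seq d i | i <- enum 'I_#|V|]) ('X - x%:P),
      forall i j, \sum_x p i x * p j x = (i == j)%:R,
      forall f : V -> R, \sum_x f x ^+ 2 = \sum_i (\sum_x p i x * f x) ^+ 2 &
      forall f : V -> R, qform e f = \sum_i d i * (\sum_x p i x * f x) ^+ 2].
Proof.
move=> e_sym; have Asym : (adjacency_mx R e)^T = adjacency_mx R e.
  by apply/matrixP => i j; rewrite !mxE e_sym.
have [P [d [PP AE]]] := sym_spectral Asym.
have sumV (F : V -> R) : \sum_x F x = \sum_(i < #|V|) F (enum_val i).
  by rewrite -big_enum_val; apply: eq_bigl.
pose u (f : V -> R) : 'rV[R]_#|V| := \row_i f (enum_val i).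
have yE f i : \sum_x P i (enum_rank x) * f x = (u f *m P^T) 0 i.
  by rewrite sumV !mxE; apply: eq_bigr => j _; rewrite enum_valK !mxE mulrC.
have sqE (v : 'rV[R]_#|V|) : \sum_i v 0 i ^+ 2 = (v *m v^T) 0 0.
  by rewrite mxE; apply: eq_bigr => i _; rewrite mxE expr2.
exists (fun i x => P i (enum_rank x)), (fun i => d 0 i); split.
- by rewrite AE char_poly_spectral // big_map big_enum.
- move=> i j; rewrite sumV; move/matrixP/(_ i j): PP; rewrite !mxE => <-.
  by apply: eq_bigr => l _; rewrite enum_valK mxE.
- move=> f; under [RHS]eq_bigr do rewrite yE.
  rewrite sqE trmx_mul trmxK mulmxA -[_ *m P^T *m P]mulmxA (mulmx1C PP) mulmx1.
  by rewrite -sqE sumV; apply: eq_bigr => i _; rewrite mxE.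
- move=> f; under [RHS]eq_bigr do rewrite yE.
  transitivity ((u f *m adjacency_mx R e *m (u f)^T) 0 0).
    rewrite mxE /qform exchange_big /= sumV; apply: eq_bigr => j _.
    rewrite !mxE mulr_suml sumV; apply: eq_bigr => i _; rewrite !mxE; ring.
  rewrite AE !mulmxA -[_ *m P *m _]mulmxA.
  have -> : P *m (u f)^T = (u f *m P^T)^T by rewrite trmx_mul trmxK.
  rewrite mul_mx_diag mxE; apply: eq_bigr => i _; rewrite [X in X * _]mxE [X in _ * X]mxE.
  by rewrite expr2 mulrA [d 0 i * _]mulrC.
Qed.

(** If at least [k] eigenvalues are at most [mu], their eigenvectors form a frame. If fewer are, a
    dimension count gives a nonzero combination of any frame that is orthogonal to all of those
    eigenvectors, and its form would be too large. *)
Lemma courant_fischer (R : realType) (V : finType) (e : rel V) k (mu : R) :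
  symmetric e -> (0 < k <= #|V|)%N ->
  lambda R e (#|V| - k + 1) <= mu <-> low_frame k e mu.
Proof.
move=> e_sym /andP[k0 kn].
have [p [d [dE pp nE qE]]] := graph_eigenbasis R e_sym.
set s := [seq d i | i <- enum 'I_#|V|] in dE.
have ss : size s = #|V| by rewrite size_map size_enum_ord.
have := nth_eigenvalues_le mu dE _ => /(_ k); rewrite k0 ss kn => /(_ isT).
rewrite /lambda addn1 /= => ->.
pose I := [pred i | d i <= mu].
have -> : count (<= mu) s = #|I|.
  by rewrite count_map [#|I|]cardE size_filter -enumT; apply: eq_count.
split=> [kI|[w wP]].
  pose g (a : 'I_k) : 'I_#|V| := enum_val (widen_ord kI a).
  have ginj : injective g by move=> a b /enum_val_inj/(congr1 val)/= /val_inj.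
  have gI a : d (g a) <= mu by have := enum_valP (widen_ord kI a); rewrite inE.
  have coef c i : \sum_x p i x * comb (fun a => p (g a)) c x = extend g c i.
    rewrite /comb; under eq_bigr do rewrite mulr_sumr.
    rewrite exchange_big /= /extend [RHS]big_mkcond /=; apply: eq_bigr => a _.
    under eq_bigr do rewrite mulrCA; rewrite -mulr_sumr pp eq_sym.
    by case: eqP; rewrite ?mulr1 ?mulr0.
  (* A general [F] lets one change of index serve both the norm and the form. *)
  have coefs c (F : 'I_#|V| -> R -> R) : (forall i, F i 0 = 0) ->
      \sum_i F i (\sum_x p i x * comb (fun a => p (g a)) c x) = \sum_a F (g a) (c a).
    move=> F0; under eq_bigr do rewrite coef.
    rewrite (sum_codom ginj); first by apply: eq_bigr => a _; rewrite extend_inj.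
    by move=> i /extend_out ->.
  exists (fun a => p (g a)) => c; rewrite nE qE; split.
    by rewrite (coefs c (fun _ x => x ^+ 2)) // => i; rewrite expr0n.
  rewrite (coefs c (fun i x => d i * x ^+ 2)); last by move=> i; rewrite expr0n mulr0.
  by rewrite mulr_sumr; apply: ler_sum => a _; rewrite ler_wpM2r ?sqr_ge0.
rewrite leqNgt; apply/negP => Ik.
(* A left kernel vector of [M] gives the coefficients of a combination orthogonal to every
   eigenvector with eigenvalue at most [mu]. *)
pose M : 'M[R]_(k, #|I|) := \matrix_(a, j) \sum_x p (enum_val j) x * w a x.
have /rowV0Pn[v vM v0] : kermx M != 0.
  rewrite -mxrank_eq0 mxrank_ker -lt0n subn_gt0.
  exact: leq_ltn_trans (rank_leq_col M) Ik.
have {}vM : v *m M = 0 by apply/sub_kermxP.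
pose c a := v 0 a; have [cN cQ] := wP c.
pose y i := \sum_x p i x * comb w c x.
have yI i : d i <= mu -> y i = 0.
  move=> di; have iI : i \in I by rewrite inE.
  have := congr1 (fun A : 'M[R]_(1, #|I|) => A 0 (enum_rank_in iI i)) vM.
  rewrite !mxE => <-; rewrite /y /comb; under eq_bigr do rewrite mulr_sumr.
  rewrite exchange_big /=; apply: eq_bigr => a _; rewrite mxE enum_rankK_in //.
  by rewrite mulr_sumr; apply: eq_bigr => x _; rewrite mulrCA.
(* All terms (d_j - mu) y_j^2 are nonnegative, while [cQ] makes their sum at most 0. Hence all
   coordinates vanish, and the isometry in [cN] forces c = 0. *)
have y0 i : y i = 0.
  have [/yI//|di] := leP (d i) mu.
  move: cQ; rewrite -cN nE qE mulr_sumr -subr_ge0 -sumrB => h.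
  have hj j : true -> 0 <= (d j - mu) * y j ^+ 2.
    by move=> _; have [/yI->|dj] := leP (d j) mu;
      rewrite ?expr0n ?mulr0 // mulr_ge0 ?sqr_ge0 // subr_ge0 ltW.
  have h0 : \sum_j (d j - mu) * y j ^+ 2 = 0.
    apply/eqP; rewrite eq_le sumr_ge0 // andbT.
    rewrite -oppr_ge0 -sumrN (le_trans h) // ler_sum // => j _.
    by rewrite -mulrBl -mulNr opprB.
  have /eqP : (d i - mu) * y i ^+ 2 = 0 by apply: (psumr_eq0P hj h0).
  by rewrite mulf_eq0 subr_eq0 gt_eqF //= sqrf_eq0 => /eqP.
case/eqP: v0; apply/rowP => a; rewrite mxE.
move: cN; rewrite nE big1; last by move=> i _; rewrite -/(y i) y0 expr0n.
move=> /esym c0; apply/eqP; rewrite -sqrf_eq0; apply/eqP.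
by apply: (psumr_eq0P _ c0) => // b _; apply: sqr_ge0.
Qed.

(** * Subdivisions as chains *)

Lemma set2_eqE (T : finType) (x y p q : T) :
  ([set x; y] == [set p; q])%SET = (x == p) && (y == q) || (x == q) && (y == p).
Proof.
apply/idP/idP; last by move=> /orP[] /andP[/eqP -> /eqP ->]; rewrite // finset.setUC.
move=> /eqP E; have : q \in [set x; y]%SET by rewrite E set22.
have : p \in [set x; y]%SET by rewrite E set21.
have : y \in [set p; q]%SET by rewrite -E set22.
have : x \in [set p; q]%SET by rewrite -E set21.
rewrite !inE => /orP[] /eqP -> /orP[] /eqP ->; rewrite ?eqxx ?orbT //.
- by rewrite !orbb => _ /eqP ->; rewrite eqxx.
- by rewrite !orbb => /eqP -> _; rewrite eqxx.
Qed.

Section Chain.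
Local Open Scope nat_scope.
Variables (T : finType) (e : rel T) (S : {set {set T}}).

(* [subdivision] for [t >= 2], with the paths cut at the edges numbered in [c]. *)
Definition chain (s : nat) (c : pred nat) : rel (subdiv_vertex S s) := fun x y =>
  match x, y with
  | inl u, inl v => e u v && ([set u; v]%SET \notin S)
  | inl u, inr (a, i) | inr (a, i), inl u =>
      ((u == (val a).1) && (i == 0 :> nat)) || ((u == (val a).2) && (i.+2 == s))
  | inr (a, i), inr (b, j) =>
      (a == b) && (((j == i.+1 :> nat) && ~~ c j) || ((i == j.+1 :> nat) && ~~ c i))
  end.

Arguments chain s c x y : clear implicits.

Lemma path_vertex_inner s (a : Defs.arc S) i (is_ : i < s.-1) :
  path_vertex s a i.+1 = inr (a, Ordinal is_).
Proof. by rewrite /path_vertex /= insubT. Qed.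

Lemma path_vertex_last s (a : Defs.arc S) : 0 < s -> path_vertex s a s = inl (val a).2.
Proof.
by case: s => // s _; rewrite /path_vertex /=; case: insubP => [j|//]; rewrite ltnn.
Qed.

Lemma eq_inner s (b b' : Defs.arc S) (p q : 'I_s.-1) :
  ((inr (b, p) : subdiv_vertex S s) == inr (b', q)) = (b' == b) && (p == q :> nat).
Proof. by rewrite (eq_sym b'). Qed.

(** Internal vertex [p] sits at position p + 1 of its path. So edge [i] joins internal vertices i -
    1 and i, except that edge 0 starts at the first endpoint and edge s - 1 ends at the second. *)
Lemma path_edgeE s (a : Defs.arc S) i (x y : subdiv_vertex S s) : 1 < s -> i < s ->
  path_edge a i x y =
  match x, y with
  | inl _, inl _ => false
  | inl u, inr (b, p) | inr (b, p), inl u =>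
      (a == b) && ([&& i == 0, p == 0 :> nat & u == (val a).1] ||
                   [&& i == s.-1, p.+2 == s & u == (val a).2])
  | inr (b, p), inr (b', q) =>
      [&& a == b, a == b' &
          ((i == q) && (q == p.+1 :> nat)) || ((i == p) && (p == q.+1 :> nat))]
  end.
Proof.
move=> s1 is_; rewrite /path_edge set2_eqE.
pose V := subdiv_vertex S s.
have Ell u v : ((inl u : V) == inl v) = (u == v) by [].
have Elr u b : ((inl u : V) == inr b) = false by [].
have Erl u b : ((inr b : V) == inl u) = false by [].
(* Three cases: the first edge, the last edge, and an edge between two internal vertices. *)
case: i is_ => [|i] is_.
  have s0 : 0 < s.-1 by lia.
  rewrite path_vertex_inner /path_vertex /=.
  case: x y => [u|[b p]] [v|[b' q]];
    rewrite ?(Ell, Elr, Erl, eq_inner) /= ?andbF ?orbF //;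
    try have := ltn_ord p; try have := ltn_ord q;
    try case: (a == b); try case: (a == b');
    try case: (u == (val a).1); try case: (u == (val a).2);
    try case: (v == (val a).1); try case: (v == (val a).2); rewrite /=; try lia.
have [is1|is1] := eqVneq i.+1 s.-1.
  have is0 : i < s.-1 by lia.
  rewrite path_vertex_inner (_ : i.+2 = s) ?path_vertex_last; try lia.
  case: x y => [u|[b p]] [v|[b' q]];
    rewrite ?(Ell, Elr, Erl, eq_inner) /= ?andbF ?orbF //;
    try have := ltn_ord p; try have := ltn_ord q;
    try case: (a == b); try case: (a == b');
    try case: (u == (val a).1); try case: (u == (val a).2);
    try case: (v == (val a).1); try case: (v == (val a).2); rewrite /=; try lia.
have is0 : i < s.-1 by lia.
have is2 : i.+1 < s.-1 by lia.
rewrite !path_vertex_inner; case: x y => [u|[b p]] [v|[b' q]];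
    rewrite ?(Ell, Elr, Erl, eq_inner) /= ?andbF ?orbF //;
    try have := ltn_ord p; try have := ltn_ord q;
    try case: (a == b); try case: (a == b');
    try case: (u == (val a).1); try case: (u == (val a).2);
    try case: (v == (val a).1); try case: (v == (val a).2); rewrite /=; try lia.
Qed.

Lemma subdivision_chain s : 1 < s -> subdivision e S s =2 chain s pred0.
Proof.
move=> s1 x y; rewrite /subdivision.
have -> : [exists a : Defs.arc S, exists i : 'I_s, path_edge a i x y] =
   if (x, y) is (inl _, inl _) then false else chain s pred0 x y.
  have i0 : 0 < s by lia.
  have i1 : s.-1 < s by lia.
  apply/existsP/idP => [[a /existsP[[i /= is_]]]|].
    rewrite path_edgeE //; case: x y => [u|[b p]] [v|[b' q]] //=.
    - by move=> /andP[/eqP -> /orP[] /and3P[_ -> ->]]; rewrite ?orbT.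
    - by move=> /andP[/eqP -> /orP[] /and3P[_ -> ->]]; rewrite ?orbT.
    - by move=> /and3P[/eqP <- /eqP <- /orP[] /andP[_ ->]]; rewrite eqxx ?orbT.
  (* The witness is edge 0 or s - 1 at an original vertex, and the larger index when both vertices
     are internal. *)
  case: x y => [u|[b p]] [v|[b' q]] //=.
  - move=> /orP[] /andP[ub qb].
      by exists b'; apply/existsP; exists (Ordinal i0); rewrite path_edgeE //= qb ub eqxx.
    by exists b'; apply/existsP; exists (Ordinal i1);
      rewrite path_edgeE //= qb ub !eqxx orbT.
  - move=> /orP[] /andP[ub qb].
      by exists b; apply/existsP; exists (Ordinal i0); rewrite path_edgeE //= qb ub eqxx.
    by exists b; apply/existsP; exists (Ordinal i1);
      rewrite path_edgeE //= qb ub !eqxx orbT.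
  - move=> /andP[/eqP <-]; rewrite !andbT => /orP[] /eqP pq.
      have qs : q < s by have := ltn_ord q; lia.
      by exists b; apply/existsP; exists (Ordinal qs); rewrite path_edgeE //= pq !eqxx.
    have ps : p < s by have := ltn_ord p; lia.
    by exists b; apply/existsP; exists (Ordinal ps); rewrite path_edgeE //= pq !eqxx orbT.
by case: x y => [u|[b p]] [v|[b' q]] //=; rewrite orbF.
Qed.

(** The bounds on [j] keep the cut off the two end edges, so only adjacency between internal
    vertices changes. *)
Lemma cut_chain s j : 0 < j < s.-1 ->
  (fun x y => subdivision e S s x y && ~~ [exists a : Defs.arc S, path_edge a j x y])
    =2 chain s (pred1 j).
Proof.
move=> /andP[j0 js] x y.
have s1 : 1 < s by lia.
have js' : j < s by lia.
have j0' : (j == 0) = false by lia.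
have js'' : (j == s.-1) = false by lia.
rewrite subdivision_chain //.
have -> : [exists a : Defs.arc S, path_edge a j x y] =
   if (x, y) is (inr (a, p), inr (b, q)) then
     (a == b) && ((j == q) && (q == p.+1 :> nat) || (j == p) && (p == q.+1 :> nat))
   else false.
  apply/existsP/idP => [[a]|].
    rewrite path_edgeE //; case: x y => [u|[b p]] [v|[b' q]] //=.
    - by rewrite j0' js'' andbF.
    - by rewrite j0' js'' andbF.
    - by move=> /and3P[/eqP <- /eqP <- ->]; rewrite eqxx.
  case: x y => [u|[b p]] [v|[b' q]] //= /andP[/eqP <- h].
  by exists b; rewrite path_edgeE // h !eqxx.
case: x y => [u|[b p]] [v|[b' q]] //=; rewrite ?andbT //.
by case: (b == b') => //=; lia.
Qed.

Lemma cut_subdivision_chain t : 1 < t ->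
  cut_subdivision e S t =2 chain (2 * t + 1) (pred1 t).
Proof. by move=> t1 x y; rewrite -cut_chain //; lia. Qed.

End Chain.
Arguments chain {T} e S s c x y.

(** * Perturbation of quadratic forms *)

Section QuadraticForm.
Variables (R : realType) (V : finType).
Implicit Types (e : rel V) (f : V -> R).

Lemma eq_qform e e' f : e =2 e' -> qform e f = qform e' f.
Proof. by move=> ee; apply: eq_bigr => x _; apply: eq_bigr => y _; rewrite ee. Qed.

Lemma eq_low_frame k e e' (mu : R) : e =2 e' -> low_frame k e mu -> low_frame k e' mu.
Proof. by move=> ee [w wP]; exists w => c; rewrite -(eq_qform _ ee). Qed.

Lemma qformB e e' f : subrel e' e ->
  qform e f - qform e' f = qform (fun x y => e x y && ~~ e' x y) f.
Proof.
move=> ee; rewrite /qform -sumrB; apply: eq_bigr => x _.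
rewrite -sumrB; apply: eq_bigr => y _; rewrite -mulrBl; congr (_ * _).
by have := ee x y; case: (e' x y) => [->|_] //; rewrite ?subrr // subr0 andbT.
Qed.

(** Each |f x f y| is at most the mean of the two squares; by symmetry the double sum then collects
    at each [x] its degree times (f x)^2. *)
Lemma norm_qform_le e f (d : V -> R) : symmetric e ->
  (forall x, \sum_y (e x y)%:R <= d x) -> `|qform e f| <= \sum_x d x * f x ^+ 2.
Proof.
move=> e_sym ed.
have h : `|qform e f| <= \sum_x \sum_y (e x y)%:R * ((f x ^+ 2 + f y ^+ 2) / 2).
  apply: le_trans (ler_norm_sum _ _ _) _; apply: ler_sum => x _.
  apply: le_trans (ler_norm_sum _ _ _) _; apply: ler_sum => y _.
  rewrite normrM ger0_norm ?ler0n // ler_wpM2l ?ler0n // ler_norml.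
  have := sqr_ge0 (f x + f y); have := sqr_ge0 (f x - f y); lra.
apply: le_trans h _.
have -> : \sum_x \sum_y (e x y)%:R * ((f x ^+ 2 + f y ^+ 2) / 2) =
   \sum_x (\sum_y (e x y)%:R) * f x ^+ 2.
  pose F x y : R := (e x y)%:R * f x ^+ 2 / 2.
  transitivity (\sum_x \sum_y F x y + \sum_x \sum_y F y x).
    rewrite -big_split; apply: eq_bigr => x _; rewrite -big_split.
    by apply: eq_bigr => y _ /=; rewrite /F (e_sym y); field.
  rewrite [X in _ + X]exchange_big /= -big_split; apply: eq_bigr => x _ /=.
  by rewrite mulr_suml -big_split; apply: eq_bigr => y _ /=; rewrite /F; field.
by apply: ler_sum => x _; rewrite ler_wpM2r ?sqr_ge0.
Qed.

(** Testing a single vector of the frame against the degree bound suffices. *)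
Lemma low_frame_ge k e (mu d : R) : symmetric e -> (0 < k)%N ->
  (forall x, \sum_y (e x y)%:R <= d) -> low_frame k e mu -> - d <= mu.
Proof.
move=> e_sym k0 ed [w wP]; pose c (i : 'I_k) : R := (i == Ordinal k0)%:R.
have [cN cQ] := wP c; have := norm_qform_le (comb w c) e_sym ed.
rewrite -mulr_sumr cN; have c1 : \sum_i c i ^+ 2 = 1.
  rewrite (bigD1 (Ordinal k0)) //= /c eqxx expr1n big1 ?addr0 // => i /negbTE ->.
  by rewrite expr0n.
by rewrite c1 !mulr1 in cQ *; rewrite ler_norml => /andP[]; lra.
Qed.

(** The Cauchy-Schwarz inequality at the point [x], proved by symmetrising the double sum and using
    (c_i w_j - c_j w_i)^2 >= 0 termwise. *)
Lemma sqr_comb_le k (w : 'I_k -> V -> R) c x :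
  comb w c x ^+ 2 <= (\sum_i c i ^+ 2) * \sum_i w i x ^+ 2.
Proof.
rewrite expr2 /comb !big_distrlr /=.
pose F i j : R := c i ^+ 2 * w j x ^+ 2.
have -> : \sum_i \sum_j c i ^+ 2 * w j x ^+ 2 = \sum_i \sum_j (F i j + F j i) / 2.
  transitivity (\sum_i \sum_j F i j / 2 + \sum_i \sum_j F j i / 2).
    rewrite [X in _ + X]exchange_big -big_split; apply: eq_bigr => i _ /=.
    by rewrite -big_split; apply: eq_bigr => j _ /=; rewrite /F; field.
  rewrite -big_split; apply: eq_bigr => i _ /=.
  by rewrite -big_split; apply: eq_bigr => j _ /=; field.
apply: ler_sum => i _; apply: ler_sum => j _; rewrite /F.
have := sqr_ge0 (c i * w j x - c j * w i x); lra.
Qed.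

(** Indicator coefficients single out each [w a], which therefore has norm 1. This is the total mass
    distributed by the pigeonhole argument. *)
Lemma sum_frame k (w : 'I_k -> V -> R) :
  (forall c, \sum_x comb w c x ^+ 2 = \sum_i c i ^+ 2) ->
  \sum_x \sum_i w i x ^+ 2 = k%:R.
Proof.
move=> wN; rewrite exchange_big /=.
transitivity (\sum_(i < k) (1 : R)); last by rewrite sumr_const card_ord.
apply: eq_bigr => a _; have := wN (fun i => (i == a)%:R).
have -> : \sum_(i < k) ((i == a)%:R : R) ^+ 2 = 1.
  by rewrite (bigD1 a) //= eqxx expr1n big1 ?addr0 // => i /negbTE ->; rewrite expr0n.
move=> <-; apply: eq_bigr => x _; congr (_ ^+ 2).
by rewrite /comb (bigD1 a) //= eqxx mul1r big1 ?addr0 // => i /negbTE ->; rewrite mul0r.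
Qed.

(** The same frame works for [e']. The removed edges change the form by at most the [d]-weighted sum
    of squares, which [sqr_comb_le] bounds by [eps] times the norm, uniformly in [c]. *)
Lemma low_frame_cut k e (w : 'I_k -> V -> R) e' mu (d : V -> R) (eps : R) :
  symmetric e -> symmetric e' -> subrel e' e ->
  (forall c, \sum_x comb w c x ^+ 2 = \sum_i c i ^+ 2 /\
    qform e (comb w c) <= mu * \sum_i c i ^+ 2) ->
  (forall x, 0 <= d x) -> (forall x, \sum_y (e x y && ~~ e' x y)%:R <= d x) ->
  \sum_x d x * (\sum_i w i x ^+ 2) <= eps -> low_frame k e' (mu + eps).
Proof.
move=> e_sym e'_sym ee wP d0 dP de; exists w => c; have [cN cQ] := wP c; split=> //.
have D_sym : symmetric (fun x y => e x y && ~~ e' x y).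
  by move=> x y; rewrite e_sym e'_sym.
have := norm_qform_le (comb w c) D_sym dP; rewrite -qformB // ler_norml => /andP[_].
have : \sum_x d x * comb w c x ^+ 2 <= eps * \sum_i c i ^+ 2.
  apply: le_trans (_ : \sum_x (\sum_i c i ^+ 2) * (d x * \sum_i w i x ^+ 2) <= _).
    by apply: ler_sum => x _; rewrite [leRHS]mulrCA ler_wpM2l ?sqr_comb_le.
  by rewrite -mulr_sumr mulrC ler_wpM2r ?sumr_ge0 // => i _; rewrite sqr_ge0.
have := norm_qform_le (comb w c) D_sym dP; rewrite -qformB // ler_norml => /andP[].
rewrite mulrDl; lra.
Qed.

End QuadraticForm.

(** Extension by zero along an induced embedding preserves both the norm and the form. *)
Lemma low_frame_embed (R : realType) (V U : finType) (e : rel V) (e' : rel U)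
    (g : V -> U) k (mu : R) :
  injective g -> (forall x y, e' (g x) (g y) = e x y) ->
  low_frame k e mu -> low_frame k e' mu.
Proof.
move=> ginj ge [w wP]; exists (fun i => extend g (w i)) => c.
have [cN cQ] := wP c.
have cE : comb (fun i => extend g (w i)) c = extend g (comb w c).
  by apply/funext => y; apply: extend_comb.
rewrite cE; split.
  rewrite -cN (sum_codom ginj).
    by apply: eq_bigr => x _; rewrite extend_inj.
  by move=> y /extend_out ->; rewrite expr0n.
apply: le_trans cQ; rewrite /qform (sum_codom ginj); last first.
  by move=> y /extend_out h; rewrite big1 // => z _; rewrite h mul0r mulr0.
rewrite le_eqVlt; apply/orP; left; apply/eqP; apply: eq_bigr => x _.
rewrite (sum_codom ginj).
  by apply: eq_bigr => y _; rewrite !extend_inj // ge.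
by move=> y /extend_out ->; rewrite !mulr0.
Qed.

(** * Embeddings and cuts of chains *)

Section ChainTheory.
Variables (R : realType) (T : finType) (e : rel T) (S : {set {set T}}).
Hypothesis e_sym : symmetric e.
Local Notation arc := (Defs.arc S).

Lemma chain_sym s c : symmetric (chain e S s c).
Proof.
move=> [u|[b p]] [v|[b' q]] //=; first by rewrite e_sym finset.setUC.
by rewrite eq_sym orbC.
Qed.

(** Each path is pulled apart at its cut: the part before [j] keeps its distance to the first
    endpoint, the part after it its distance to the second. The hypotheses on [c] say that no edge
    in the image of either part is cut. *)
Lemma chain_embed s s' j (c : pred nat) : (0 < j < s.-1)%N -> (s < s')%N ->
  (forall i, (i < j)%N -> ~~ c i) -> (forall i, (j < i)%N -> ~~ c (i + (s' - s))%N) ->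
  exists g : subdiv_vertex S s -> subdiv_vertex S s',
    injective g /\ forall x y, chain e S s' c (g x) (g y) = chain e S s (pred1 j) x y.
Proof.
move=> /andP[j0 js] ss cl cr.
pose f i := (if i < j then i else i + (s' - s))%N.
have fP (i : 'I_s.-1) : (f i < s'.-1)%N.
  by rewrite /f; have := ltn_ord i; case: ifP => _; lia.
pose phi i := Ordinal (fP i).
have finj i i' : f i = f i' -> i = i' by rewrite /f; case: ifP; case: ifP; lia.
pose g (x : subdiv_vertex S s) : subdiv_vertex S s' :=
  match x with inl u => inl u | inr (a, i) => inr (a, phi i) end.
have f0 i : (f i == 0)%N = (i == 0)%N by rewrite /f; case: ifP; lia.
have fs i : (i < s.-1)%N -> ((f i).+2 == s')%N = (i.+2 == s)%N.
  by rewrite /f; case: ifP; lia.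
have fS i k : (k < s.-1)%N ->
    ((f k == (f i).+1) && ~~ c (f k))%N = ((k == i.+1) && (k != j))%N.
  rewrite /f; have [ij|ij] := ltnP i j; have [kj|kj] := ltnP k j => ks.
  - by rewrite cl // (ltn_eqF kj).
  (* Across the cut the images are at least two apart because s < s', which matches the missing edge
     [j]. *)
  - by apply/idP/idP; lia.
  - by apply/idP/idP; lia.
  - have [->|kj'] := eqVneq k j; first by rewrite andbF; lia.
    by rewrite cr ?andbT; lia.
exists g; split.
  move=> [u|[b p]] [v|[b' q]] //= [-> // /finj /val_inj ->//].
move=> [u|[b p]] [v|[b' q]] //=; rewrite ?f0 ?fs ?ltn_ord //.
by rewrite !fS ?ltn_ord.
Qed.

(** The choice of [c] covers all three comparisons: H_t in H_(t+1), H_t in G_s, and a cut G_s in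
    H_s. *)
Lemma low_frame_chain k s s' j (c : pred nat) (mu : R) :
  (0 < j < s.-1)%N -> (s < s')%N ->
  (forall i, (i < j)%N -> ~~ c i) -> (forall i, (j < i)%N -> ~~ c (i + (s' - s))%N) ->
  low_frame k (chain e S s (pred1 j)) mu -> low_frame k (chain e S s' c) mu.
Proof.
move=> js ss cl cr; have [g [ginj gE]] := chain_embed js ss cl cr.
exact: low_frame_embed ginj gE.
Qed.

Lemma sum_ord_eq_le1 n (P : pred 'I_n) :
  {in P &, forall i j, i = j} -> (\sum_(i < n) P i <= 1)%N.
Proof.
move=> P1; rewrite -big_mkcond sum1_card; apply/card_le1_eqP => i j Pi Pj.
exact: P1.
Qed.

Lemma sum_pair (I J : finType) (F : I * J -> nat) :
  (\sum_p F p = \sum_i \sum_j F (i, j))%N.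
Proof. by rewrite pair_bigA; apply: eq_bigr => -[]. Qed.

(** A vertex has at most two internal neighbours on each path, so the bound does not depend on
    [s]. *)
Lemma chain_degree s c (x : subdiv_vertex S s) :
  (\sum_y chain e S s c x y <= #|T| + 2 * #|{: arc}|)%N.
Proof.
rewrite big_sumType /=; apply: leq_add.
  by rewrite -sum1_card; apply: leq_sum => v _; apply: leq_b1.
rewrite sum_pair.
rewrite mulnC -sum_nat_const; apply: leq_sum => b _.
have le_or (P Q : pred 'I_s.-1) (F : 'I_s.-1 -> bool) :
    {in P &, forall i j, i = j} -> {in Q &, forall i j, i = j} ->
    (forall i, F i -> P i || Q i) -> (\sum_(i < s.-1) F i <= 2)%N.
  move=> P1 Q1 FPQ; apply: leq_trans (leq_add (sum_ord_eq_le1 P1) (sum_ord_eq_le1 Q1)).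
  rewrite -big_split; apply: leq_sum => i _ /=.
  by have := FPQ i; case: (F i) => // /(_ isT); case: (P i); case: (Q i).
case: x => [u|[a i]] /=.
  apply: (le_or (fun i => i == 0 :> nat)%N (fun i => i.+2 == s)).
  - by move=> i k; rewrite !unfold_in => /eqP i0 /eqP k0; apply/val_inj; rewrite /= i0 k0.
  - by move=> i k; rewrite !unfold_in => i0 k0; apply/val_inj => /=; lia.
  - by move=> i /orP[] /andP[_ ->]; rewrite ?orbT.
apply: (le_or (fun k => k == i.+1 :> nat)%N (fun k => i == k.+1 :> nat)%N).
- by move=> k k'; rewrite !unfold_in => k0 k0'; apply/val_inj => /=; lia.
- by move=> k k'; rewrite !unfold_in => k0 k0'; apply/val_inj => /=; lia.
- by move=> k /andP[_] /orP[] /andP[->]; rewrite ?orbT.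
Qed.

(** The ends of edge [j] on each path are the internal vertices j - 1 and j. *)
Definition cut_end s j (x : subdiv_vertex S s) : bool :=
  if x is inr (_, i) then (i.+1 == j) || (i == j :> nat) else false.

(** The removed edges form a matching: at most one on each path, and none between different
    paths. *)
Lemma cut_degree s j (x : subdiv_vertex S s) :
  (\sum_y (chain e S s pred0 x y && ~~ chain e S s (pred1 j) x y) <= cut_end j x)%N.
Proof.
case: x => [u|[a i]]; rewrite big_sumType /=.
  rewrite big1 ?add0n; last by move=> v _; rewrite andbN.
  by rewrite big1 // => -[b k] _; rewrite andbN.
rewrite big1 ?add0n; last by move=> v _; rewrite andbN.
rewrite sum_pair (bigD1 a) //= [X in (_ + X)%N]big1 ?addn0; last first.
  by move=> b /negbTE ba; rewrite big1 // => k _; rewrite eq_sym ba.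
rewrite eqxx /=; have [ij|ij] := boolP ((i.+1 == j) || (i == j :> nat)).
  apply: sum_ord_eq_le1 => k k'; rewrite !unfold_in => h h'; apply/val_inj => /=; lia.
by rewrite big1 // => k _; apply/eqP; rewrite eqb0; lia.
Qed.

Lemma low_frame_pigeonhole k s (mu : R) : (2 < s)%N ->
  low_frame k (chain e S s pred0) mu ->
  exists2 j, (0 < j < s.-1)%N &
    low_frame k (chain e S s (pred1 j)) (mu + 2 * k%:R / (s - 2)%:R).
Proof.
move=> s2 [w wP].
pose W x : R := \sum_i w i x ^+ 2.
have W0 x : 0 <= W x by apply: sumr_ge0 => i _; apply: sqr_ge0.
pose m j : R := \sum_(x : subdiv_vertex S s) (cut_end j x)%:R * W x.
have Wk : \sum_x W x = k%:R by apply: sum_frame => c; case: (wP c).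
(* The positions 1, ..., s - 2 are the admissible cuts. An internal vertex is an end for at most two
   of them, so the total mass [k] is counted at most twice. *)
have sum_m : \sum_(j < s - 2) m j.+1 <= 2 * k%:R.
  rewrite exchange_big -Wk mulr_sumr; apply: ler_sum => x _ /=.
  rewrite -mulr_suml ler_wpM2r // -natr_sum ler_nat.
  case: x => [u|[a i]] /=; first by rewrite big1.
  apply: (@leq_trans (\sum_(j < s - 2) (i == j :> nat) +
                      \sum_(j < s - 2) (i == j.+1 :> nat)))%N.
    by rewrite -big_split; apply: leq_sum => j _ /=; rewrite eqSS; case: eqP; case: eqP.
  by apply: (@leq_add _ _ 1 1); apply: sum_ord_eq_le1 => j j'; rewrite !unfold_in => h h';
    apply/val_inj => /=; lia.
have s20 : 0 < (s - 2)%:R :> R by rewrite ltr0n subn_gt0.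
have [j mj] : exists j : 'I_(s - 2), m j.+1 <= 2 * k%:R / (s - 2)%:R.
  apply/existsP; apply: contraT; rewrite negb_exists => /forallP h.
  have : \sum_(j < s - 2) (2 * k%:R / (s - 2)%:R) < \sum_(j < s - 2) m j.+1.
    apply: ltr_sum; last by move=> j _; rewrite ltNge.
    have i0 : (0 < s - 2)%N by rewrite subn_gt0.
    by apply/hasP; exists (Ordinal i0); rewrite ?mem_index_enum.
  rewrite sumr_const card_ord -[X in X < _]mulr_natr divfK ?gt_eqF //.
  move=> /lt_le_trans/(_ sum_m).
  by rewrite ltxx.
exists j.+1; first by have := ltn_ord j; lia.
apply: (low_frame_cut (@chain_sym s pred0) (@chain_sym s (pred1 j.+1)) _ wP _ _ mj).
- move=> [u|[b p]] [v|[b' q]] //= /andP[-> /=].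
  by move=> /orP[] /andP[-> _]; rewrite ?orbT.
- by move=> x; rewrite ler0n.
- by move=> x; rewrite -natr_sum ler_nat cut_degree.
Qed.

Lemma low_frame_chain_ge k s c (mu : R) : (0 < k)%N ->
  low_frame k (chain e S s c) mu -> - (#|T| + 2 * #|{: arc}|)%:R <= mu.
Proof.
move=> k0; apply: low_frame_ge (@chain_sym s c) k0 _ => x.
by rewrite -natr_sum ler_nat chain_degree.
Qed.

End ChainTheory.

(** * Convergence *)

Local Open Scope classical_set_scope.
Local Open Scope ring_scope.

(** From [N] on, [h] is monotone and bounded below, so it has a limit l. Then [g s] is squeezed
    between h s - C/(s - 2) and an earlier term of [h]. *)
Lemma interlaced_cvg (R : realType) (g h : nat -> R) N (D C : R) :
  0 <= C ->
  (forall t, (N <= t)%N -> h t.+1 <= h t) -> (forall t, (N <= t)%N -> D <= h t) ->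
  (forall t s, (N <= t)%N -> (2 * t + 2 <= s)%N -> g s <= h t) ->
  (forall s, (N <= s)%N -> h s <= g s + C / (s - 2)%:R) ->
  exists l : R, (fun n => g n.+1) @ \oo --> l /\ (fun n => h n.+1) @ \oo --> l.
Proof.
move=> C0 h_dec hD gh hg.
pose u n := h (n + N)%N.
have u_dec : nonincreasing_seq u.
  by apply/nonincreasing_seqP => n; rewrite /u addSn h_dec ?leq_addl.
have u_lb : has_lbound (range u).
  by exists D => _ [n _ <-]; rewrite hD ?leq_addl.
have /cvg_ex[/= l ul] := nonincreasing_is_cvgn u_dec u_lb.
have hl : h @ \oo --> l by rewrite -(cvg_shiftn N).
have l_le t : (N <= t)%N -> l <= h t.
  move=> Nt; rewrite -(subnK Nt) -/(u _) -(cvg_lim _ ul) //.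
  by apply: nonincreasing_cvgn_ge u_dec _ _; apply/cvg_ex; exists l.
exists l; split; last first.
  by move: hl; rewrite -(cvg_shiftS h).
suff : g @ \oo --> l by rewrite -(cvg_shiftS g).
apply/cvgrPdist_le => eps eps0.
move/cvgrPdist_le : (hl) => /(_ _ eps0)[M _ HM].
pose K := (maxn M N).
have [p pP] : exists p : nat, C / eps <= p%:R.
  by exists (Num.truncn (C / eps)).+1; apply/ltW/truncnS_gt.
(* This threshold gives 2K + 2 <= s, hence g s <= h K, and also p <= s - 2, hence C/(s - 2) <=
   eps. *)
exists (2 * K + 3 + p)%N => //= s; rewrite /= => sK.
have MK : (M <= K)%N := leq_maxl _ _.
have NK : (N <= K)%N := leq_maxr _ _.
have s20 : 0 < (s - 2)%:R :> R by rewrite ltr0n; lia.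
have Cs : C / (s - 2)%:R <= eps.
  rewrite ler_pdivrMr // -ler_pdivrMl // mulrC (le_trans pP) // ler_nat; lia.
have h1 : g s <= h K by apply: gh; lia.
have h2 : h s <= g s + C / (s - 2)%:R by apply: hg; lia.
have h3 : l <= h s by apply: l_le; lia.
have := HM K MK; rewrite /= !ler_norml => /andP[h4 h5].
by apply/andP; split; lra.
Qed.

Section Main.
Variables (R : realType) (T : finType) (e : rel T).
Hypothesis (e_sym : symmetric e).
Variables (S : {set {set T}}) (k : nat).
Hypothesis k_gt0 : (0 < k)%N.
Let G t := lambda R (subdivision e S t) (#|subdiv_vertex S t| - k + 1)%N.
Let H t := lambda R (cut_subdivision e S t) (#|subdiv_vertex S (2 * t + 1)| - k + 1)%N.

Lemma lambda_subdivision_le t (mu : R) : (1 < t)%N -> (k <= #|subdiv_vertex S t|)%N ->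
  G t <= mu <-> low_frame k (chain e S t pred0) mu.
Proof.
move=> t1 kt; rewrite /G courant_fischer; first last.
- by rewrite k_gt0.
- exact: subdivision_sym.
by split; apply: eq_low_frame => x y; rewrite subdivision_chain.
Qed.

Lemma lambda_cut_subdivision_le t (mu : R) : (1 < t)%N ->
  (k <= #|subdiv_vertex S (2 * t + 1)|)%N ->
  H t <= mu <-> low_frame k (chain e S (2 * t + 1) (pred1 t)) mu.
Proof.
move=> t1 kt; rewrite /H courant_fischer; first last.
- by rewrite k_gt0.
- exact: cut_subdivision_sym.
by split; apply: eq_low_frame => x y; rewrite cut_subdivision_chain.
Qed.

Lemma lambda_subdivision_cvg N :
  (forall t, (N <= t)%N -> (k <= #|subdiv_vertex S t|)%N) ->
  exists l : R, (fun n => G n.+1) @ \oo --> l /\ (fun n => H n.+1) @ \oo --> l.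
Proof.
move=> kN.
apply: (@interlaced_cvg R G H (N + 3) (- (#|T| + 2 * #|{: Defs.arc S}|)%:R) (2 * k%:R)).
- by rewrite mulr_ge0.
- move=> t Nt; apply/lambda_cut_subdivision_le; rewrite ?kN; try lia.
  (* H_t lies in H_(t+1): two internal vertices are inserted at the cut, one on each side of the new
     cut t + 1. *)
  apply: (@low_frame_chain R T e S k (2 * t + 1) _ t); try lia.
  + by move=> i /= it; rewrite neq_ltn; lia.
  + by move=> i /= it; rewrite neq_ltn; lia.
  by apply/lambda_cut_subdivision_le; rewrite ?kN; try lia.
- move=> t Nt; apply: (low_frame_chain_ge e_sym k_gt0 (s := 2 * t + 1) (c := pred1 t)).
  by apply/lambda_cut_subdivision_le; rewrite ?kN; try lia.
- move=> t s Nt ts; apply/lambda_subdivision_le; rewrite ?kN; try lia.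
  (* H_t lies in the uncut G_s, since s >= 2t + 2 leaves a vertex separating the two halves of each
     path. *)
  apply: (@low_frame_chain R T e S k (2 * t + 1) _ t) => //; try lia.
  by apply/lambda_cut_subdivision_le; rewrite ?kN; try lia.
- move=> s Ns.
  have s1 : (2 < s)%N by lia.
  (* Taking [mu] to be the eigenvalue itself yields an optimal frame. *)
  have : low_frame k (chain e S s pred0) (G s).
    by apply/lambda_subdivision_le; rewrite ?kN; try lia.
  move=> /(low_frame_pigeonhole e_sym s1)[j js lj].
  apply/lambda_cut_subdivision_le; rewrite ?kN; try lia.
  (* G_s cut at [j] lies in H_s: both remaining parts are shorter than [s], so they avoid the middle
     edge [s] of a path of length 2s + 1. *)
  apply: (low_frame_chain js _ _ _ lj); try lia.
  + by move=> i /= it; rewrite neq_ltn; lia.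
  + by move=> i /= it; rewrite neq_ltn; lia.
Qed.

End Main.

Lemma size_eigenvalues_adjacency (R : realType) (V : finType) (e : rel V) :
  symmetric e -> size (eigenvalues (adjacency_mx R e)) = #|V|.
Proof.
move=> e_sym; have [p [d [dE _ _ _]]] := graph_eigenbasis R e_sym.
by rewrite (perm_size (perm_eigenvalues dE)) size_map size_enum_ord.
Qed.

(* [t.+1] ranges over the integers t >= 1. *)
Theorem theorem1p2 (R : realType) (T : finType) (e : rel T)
    (e_sym : symmetric e) (e_irr : irreflexive e)
    (S : {set {set T}}) (S_edges : S \subset edge_set e)
    (k : nat) (k_gt0 : (0 < k)%N) :
  let lamG := fun n : nat => let t := n.+1 in
    lambda R (subdivision e S t)
      (#|subdiv_vertex S t| - k + 1)%N in
  let lamH := fun n : nat => let t := n.+1 in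
    lambda R (cut_subdivision e S t)
      (#|subdiv_vertex S (2 * t + 1)| - k + 1)%N in
  [/\ cauchy (lamG @ \oo), cauchy (lamH @ \oo) &
      lim (lamG @ \oo) = lim (lamH @ \oo)].
Proof.
have cardV t : (#|subdiv_vertex S t| = #|T| + (t - 1) * #|S|)%N.
  exact: card_subdiv_vertex.
suff main : exists l : R,
    (fun n => lambda R (subdivision e S n.+1)
      (#|subdiv_vertex S n.+1| - k + 1)%N) @ \oo --> l /\
    (fun n => lambda R (cut_subdivision e S n.+1)
      (#|subdiv_vertex S (2 * n.+1 + 1)| - k + 1)%N) @ \oo --> l.
  move=> lamG lamH; have [l [Gl Hl]] := main.
  have GC : lamG @ \oo --> l := Gl.
  have HC : lamH @ \oo --> l := Hl.
  split.
  - by apply: cvg_cauchy; apply/cvg_ex; exists l.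
  - by apply: cvg_cauchy; apply/cvg_ex; exists l.
  - by rewrite (cvg_lim _ GC) // (cvg_lim _ HC).
(* If [S] is nonempty the order grows at least like t - 1, so it reaches [k] once t >= k + 1.
   Otherwise the order is constantly |T|. *)
have [S0|S0] := posnP #|S|; last first.
  apply: (@lambda_subdivision_cvg R T e e_sym S k k_gt0 k.+1) => t kt.
  by rewrite cardV; nia.
have cardT t : #|subdiv_vertex S t| = #|T| by rewrite cardV S0 muln0 addn0.
have [kT|Tk] := leqP k #|T|.
  by apply: (@lambda_subdivision_cvg R T e e_sym S k k_gt0 0) => t _; rewrite cardT.
(* The truncated index is 1, as for [k = #|T|]. *)
have idx t : (#|subdiv_vertex S t| - k + 1 = #|subdiv_vertex S t| - #|T| + 1)%N.
  by rewrite cardT; lia.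
(* Without vertices the list of eigenvalues is empty, so [lambda] takes the default value 0 of
   [nth]; otherwise the case k = |T| applies. *)
have [T0|T0] := posnP #|T|.
  exists 0; split.
    rewrite (_ : (fun n => _) = cst 0); first exact: cvg_cst.
    apply/funext => n; rewrite /lambda nth_default //.
    rewrite size_eigenvalues_adjacency ?cardT ?T0 //.
    exact: subdivision_sym.
  rewrite (_ : (fun n => _) = cst 0); first exact: cvg_cst.
  apply/funext => n; rewrite /lambda nth_default //.
    rewrite size_eigenvalues_adjacency ?cardT ?T0 //.
  exact: cut_subdivision_sym.
have [l [Gl Hl]] := @lambda_subdivision_cvg R T e e_sym S #|T| T0 0
  (fun t _ => eq_leq (esym (cardT t))).
by exists l; split; under eq_fun do rewrite idx.
Qed.
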